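(* Let $\widehat{A}=A+\varepsilon B$ be an $n\times n$ dual matrix with $A,B\in\mathbb{R}^{n\times n}$. Then the dual index of $\widehat{A}$ is one if and only if $\mathrm{Ind}(A)=1$ and the dual Moore–Penrose generalized inverse $\widehat{A}^{+}$ exists.
   Context: Dual numbers are $a+\varepsilon a'$ with $a,a'\in\mathbb{R}$ and $\varepsilon\neq 0$, $\varepsilon^2=0$ (i.e. the ring $\mathbb{R}[\varepsilon]/(\varepsilon^2)$). A dual matrix is a matrix over dual numbers, written $\widehat{A}=A+\varepsilon B$ with $A,B$ real; its transpose is $\widehat{A}^{T}=A^{T}+\varepsilon B^{T}$. The range $\mathcal{R}(\widehat{A})$ of an $n\times n$ dual matrix is $\{\widehat{A}\widehat{x}: \widehat{x}$ a dual column vector of length $n\}$. The dual index of an $n\times n$ dual matrix $\widehat{A}$ is said to be equal to one if $\mathcal{R}(\widehat{A}^2)=\mathcal{R}(\widehat{A})$. For a real square matrix $A$, ''$\mathrm{Ind}(A)=1$'' means $\mathrm{rank}(A^2)=\mathrm{rank}(A)$. The dual Moore–Penrose generalized inverse (DMPGI) $\widehat{A}^{+}$ of $\widehat{A}$ is a dual matrix $\widehat{X}$ with $\widehat{A}\widehat{X}\widehat{A}=\widehat{A}$, $\widehat{X}\widehat{A}\widehat{X}=\widehat{X}$, $(\widehat{A}\widehat{X})^{T}=\widehat{A}\widehat{X}$, $(\widehat{X}\widehat{A})^{T}=\widehat{X}\widehat{A}$; it may or may not exist. *)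

(* Defs.v *)
From HB Require Import structures.
From mathcomp Require Import all_boot all_order all_algebra.
From mathcomp Require Import qpoly.
From mathcomp Require Import classical_sets reals.

Set Implicit Arguments.
Unset Strict Implicit.
Unset Printing Implicit Defensive.

Import GRing.Theory.
Local Open Scope ring_scope.
Local Open Scope classical_set_scope.

Notation dual R := {poly %/ ('X^2 : {poly R})}.

Definition dual_eps (R : realType) : dual R := 'qX.

(* [mk_monic], hidden inside {poly %/ p}, replaces p by 'X when p is not monic
   of size > 1; the lemmas below witness that this fallback is not taken. *)
Lemma dual_eps_polyE (R : realType) : dual_eps R = 'X :> {poly R}.
Proof. by rewrite qpolyXE ?size_polyXn ?monicXn. Qed.

Lemma dual_eps_neq0 (R : realType) : dual_eps R != 0.
Proof.
apply/eqP => eps0; have := dual_eps_polyE R; rewrite eps0 => /eqP.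
by rewrite eq_sym polyX_eq0.
Qed.

Lemma dual_eps_sqr (R : realType) : dual_eps R ^+ 2 = 0.
Proof.
rewrite (expr2 (dual_eps R)) -in_qpolyM; apply/val_inj => /=.
by rewrite mk_monic_Xn -expr2 Pdiv.RingMonic.rmodpp ?monicXn.
Qed.

Definition dual_mx (R : realType) (m n : nat) (A B : 'M[R]_(m, n)) :
    'M[dual R]_(m, n) :=
  map_mx (in_alg (dual R)) A + dual_eps R *: map_mx (in_alg (dual R)) B.

Definition dual_range (R : realType) (n : nat) (A : 'M[dual R]_n) :
    set 'cV[dual R]_n :=
  range (fun x : 'cV[dual R]_n => A *m x).

Definition dual_index_one (R : realType) (n : nat) (A : 'M[dual R]_n) : Prop :=
  dual_range (A *m A) = dual_range A.

(* Invertible matrices, of index 0 in the usual terminology, are included. *)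
Definition index_one (R : realType) (n : nat) (A : 'M[R]_n) : Prop :=
  \rank (A *m A) = \rank A.

Definition is_DMPGI (R : realType) (n : nat) (A X : 'M[dual R]_n) : Prop :=
  [/\ A *m X *m A = A,
      X *m A *m X = X,
      (A *m X)^T = A *m X
    & (X *m A)^T = X *m A].

(* Main.v *)
(** Write [A + eps B] for the dual matrix. If [Ind A = 1], there is an idempotent
    [E = A G = G A] with [A E = A = E A] ([G] is the group inverse of [A]). Given
    [Ind A = 1], both the solvability of [(A + eps B)^2 Y = A + eps B] and the
    existence of a dual Moore-Penrose inverse are equivalent to
    [(1 - E) B (1 - E) = 0]: multiplying the [eps]-part of either equation by
    [1 - E] on both sides gives necessity, and explicit solutions give
    sufficiency. *)
Require Import Defs.
From mathcomp Require Import all_boot all_order all_algebra.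
From mathcomp Require Import qpoly.
From mathcomp Require Import boolp classical_sets reals.

Set Implicit Arguments.
Unset Strict Implicit.
Unset Printing Implicit Defensive.

Import Order.TTheory GRing.Theory Num.Theory.
Local Open Scope ring_scope.

(** * Real and dual parts of a dual matrix *)

Section DualMatrix.
Variable R : realType.

Lemma dual_val (a b : R) :
  in_alg (dual R) a + dual_eps R * in_alg (dual R) b = a%:P + b *: 'X :> {poly R}.
Proof.
by rewrite -scalerAr mulr1 -[X in _ = _ + b *: X](dual_eps_polyE R) -alg_polyC.
Qed.

Lemma dual_decomp (x : dual R) :
  x = in_alg (dual R) (x : {poly R})`_0
      + dual_eps R * in_alg (dual R) (x : {poly R})`_1.
Proof.
apply/val_inj; rewrite [RHS]dual_val /=.
have sx : (size (x : {poly R}) <= 2)%N.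
  by rewrite -ltnS (leq_trans (size_mk_monic x)) // mk_monic_Xn size_polyXn.
apply/polyP => i; rewrite coefD coefC coefZ coefX.
case: i => [|[|i]] /=; rewrite ?mulr0 ?mulr1 ?addr0 ?add0r //.
by rewrite nth_default // (leq_trans sx).
Qed.

Lemma dual_inj (a b c d : R) :
  in_alg (dual R) a + dual_eps R * in_alg (dual R) b =
  in_alg (dual R) c + dual_eps R * in_alg (dual R) d -> a = c /\ b = d.
Proof.
move=> /(congr1 val); rewrite [LHS]dual_val [RHS]dual_val => e.
split.
  by have := congr1 (fun p : {poly R} => p`_0) e;
     rewrite /= !coefD !coefC !coefZ !coefX /= !mulr0 !addr0.
by have := congr1 (fun p : {poly R} => p`_1) e;
   rewrite /= !coefD !coefC !coefZ !coefX /= !mulr1 !add0r.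
Qed.

Lemma dual_mx_ex m n (X : 'M[dual R]_(m, n)) :
  exists A, exists B, X = dual_mx A B.
Proof.
exists (map_mx (fun x : dual R => (x : {poly R})`_0) X).
exists (map_mx (fun x : dual R => (x : {poly R})`_1) X).
by apply/matrixP => i j; rewrite !mxE -dual_decomp.
Qed.

Lemma dual_mx_inj m n (A B C D : 'M[R]_(m, n)) :
  dual_mx A B = dual_mx C D -> A = C /\ B = D.
Proof.
move=> /matrixP e.
by split; apply/matrixP => i j; have := e i j; rewrite !mxE => /dual_inj[].
Qed.

Lemma mul_dual_mx m n p (A B : 'M[R]_(m, n)) (C D : 'M[R]_(n, p)) :
  dual_mx A B *m dual_mx C D = dual_mx (A *m C) (A *m D + B *m C).
Proof.
rewrite /dual_mx mulmxDl !mulmxDr -!scalemxAl -!scalemxAr scalerA.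
by rewrite -expr2 dual_eps_sqr scale0r addr0 map_mxD !map_mxM scalerDr addrA.
Qed.

Lemma tr_dual_mx m n (A B : 'M[R]_(m, n)) : (dual_mx A B)^T = dual_mx A^T B^T.
Proof. by apply/matrixP => i j; rewrite !mxE. Qed.

(** Every column of [A] lies in its range, so equality of ranges supplies, column by column, a
    preimage under [A *m A]; these preimages are the columns of [Y]. *)
Lemma dual_index_oneP n (A : 'M[dual R]_n) :
  dual_index_one A <-> exists Y, A *m A *m Y = A.
Proof.
split=> [e|[Y e]].
  have H j : exists y, A *m A *m y = col j A.
    have : dual_range A (col j A).
      by exists (delta_mx j 0) => //; rewrite -colE.
    by rewrite -e => -[y _ <-]; exists y.
  have [y yP] := choice H.
  exists (\matrix_(i, j) y j i 0).
  apply/matrixP => i j; have /matrixP/(_ i 0) := yP j.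
  rewrite [RHS]mxE => <-; rewrite !mxE.
  by apply: eq_bigr => k _; rewrite !mxE.
apply/seteqP; split=> [_ [x _ <-]|_ [x _ <-]].
  by exists (A *m x) => //; rewrite mulmxA.
by exists (Y *m x) => //; rewrite mulmxA e.
Qed.

End DualMatrix.

(** * Rank condition and group inverse over a field *)

Section GroupInverse.
Variables (F : fieldType) (n : nat).
Implicit Types A : 'M[F]_n.

Lemma rank_sqr_of_factor A Y : A *m A *m Y = A -> \rank (A *m A) = \rank A.
Proof.
by move=> e; apply/eqP; rewrite eqn_leq mxrankM_maxl -{1}e mxrankM_maxl.
Qed.

Lemma rank_sqr_factorl A :
  \rank (A *m A) = \rank A -> exists C, A = C *m (A *m A).
Proof.
move=> e; apply/submxP.
by have /mxrank_leqif_sup/geq_leqif <- := submxMl A A; rewrite e.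
Qed.

(** Equal ranks give [A = C A^2] and, by transposition, [A = A^2 D]. Hence [C A = C A^2 D = A D],
    and [G = C A D] satisfies [A G = C A = G A]. *)
Lemma group_inverse_ex A : \rank (A *m A) = \rank A ->
  exists G, A *m G = G *m A /\ A *m G *m A = A.
Proof.
move=> e; have [C eC] := rank_sqr_factorl e.
have [D' eD'] : exists D', A^T = D' *m (A^T *m A^T).
  by apply: rank_sqr_factorl; rewrite -trmx_mul !mxrank_tr.
have eD : A = A *m A *m D'^T.
  by apply: trmx_inj; rewrite !trmx_mul trmxK.
have eCD : C *m A = A *m D'^T by rewrite {1}eD !mulmxA -(mulmxA C) -eC.
have AGE : A *m (C *m A *m D'^T) = C *m A.
  by rewrite eCD !mulmxA -eD -eCD.
have GAE : C *m A *m D'^T *m A = C *m A.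
  by rewrite -(mulmxA C) -eCD -!mulmxA -eC.
exists (C *m A *m D'^T); split; rewrite AGE ?GAE //.
by rewrite -mulmxA -eC.
Qed.

End GroupInverse.

(** * Real Moore-Penrose inverse by full-rank factorization *)

Section MoorePenrose.
Variable R : realFieldType.

Lemma mulmx_tr_eq0 m n (A : 'M[R]_(m, n)) : A *m A^T = 0 -> A = 0.
Proof.
move=> /matrixP e; apply/matrixP => i j; have := e i i; rewrite !mxE.
under eq_bigr do rewrite mxE -expr2.
move=> /eqP; rewrite psumr_eq0 => [|k _]; last exact: sqr_ge0.
by move=> /allP/(_ j (mem_index_enum _)); rewrite sqrf_eq0 => /eqP.
Qed.

(** If [u A A^T = 0] then [(u A) (u A)^T = 0], a sum of squares, so [u A = 0]. *)
Lemma gram_unitmx m n (A : 'M[R]_(m, n)) : row_free A -> A *m A^T \in unitmx.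
Proof.
move=> fA; rewrite -row_free_unit -kermx_eq0 -submx0.
apply/rV_subP => u /sub_kermxP; rewrite mulmxA => e.
suff -> : u = 0 by exact: sub0mx.
apply: (row_free_inj fA); rewrite mul0mx.
by apply: mulmx_tr_eq0; rewrite trmx_mul mulmxA e mul0mx.
Qed.

Lemma moore_penrose_ex m n (A : 'M[R]_(m, n)) :
  exists M : 'M[R]_(n, m), [/\ A *m M *m A = A, M *m A *m M = M,
    (A *m M)^T = A *m M & (M *m A)^T = M *m A].
Proof.
move: (row_base_free A) (col_base_full A) (mulmx_base A).
move: (\rank A) (row_base A) (col_base A) => r H F fH fF <-.
have uH : H *m H^T \in unitmx by exact: gram_unitmx.
have uF : F^T *m F \in unitmx.
  rewrite -{2}[F]trmxK; apply: gram_unitmx.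
  by rewrite /row_free mxrank_tr.
(* With the matrix factored as [F H], [P] is a right inverse of [H] and [Q] a left inverse of [F];
   the products with [P Q] collapse to the symmetric projectors [F Q] and [P H]. *)
pose P := H^T *m invmx (H *m H^T); pose Q := invmx (F^T *m F) *m F^T.
have HP : H *m P = 1%:M by rewrite mulmxA mulmxV.
have QF : Q *m F = 1%:M by rewrite -mulmxA mulVmx.
have AM : F *m H *m (P *m Q) = F *m Q by rewrite mulmxA -(mulmxA F) HP mulmx1.
have MA : P *m Q *m (F *m H) = P *m H by rewrite mulmxA -(mulmxA P) QF mulmx1.
exists (P *m Q); split; rewrite ?AM ?MA.
- by rewrite -mulmxA (mulmxA Q) QF mul1mx.
- by rewrite -mulmxA (mulmxA H) HP mul1mx.
- by rewrite !trmx_mul trmx_inv trmx_mul trmxK mulmxA.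
- by rewrite !trmx_mul trmx_inv trmx_mul trmxK mulmxA.
Qed.

End MoorePenrose.

(** * Lifting a real Moore-Penrose inverse to the dual matrix *)

Section DualMoorePenrose.
Variables (R : realType) (n : nat).
Implicit Types A B M : 'M[R]_n.

Lemma DMPGI_ex A B M :
  A *m M *m A = A -> M *m A *m M = M ->
  (A *m M)^T = A *m M -> (M *m A)^T = M *m A ->
  (1%:M - A *m M) *m B *m (1%:M - M *m A) = 0 ->
  exists X, is_DMPGI (dual_mx A B) X.
Proof.
move=> AMA MAM sAM sMA B0.
pose P := 1%:M - A *m M; pose Q := 1%:M - M *m A.
have PA : P *m A = 0 by rewrite mulmxBl mul1mx AMA subrr.
have AQ : A *m Q = 0 by rewrite mulmxBr mulmx1 mulmxA AMA subrr.
have MP : M *m P = 0 by rewrite mulmxBr mulmx1 mulmxA MAM subrr.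
have QM : Q *m M = 0 by rewrite mulmxBl mul1mx MAM subrr.
have PT : P^T = P by rewrite linearB /= trmx1 sAM.
have QT : Q^T = Q by rewrite linearB /= trmx1 sMA.
have AMMt : A *m M *m M^T = M^T by rewrite -sAM -trmx_mul mulmxA MAM.
have MtMA : M^T *m M *m A = M^T by rewrite -mulmxA -sMA -trmx_mul MAM.
(* [M M^T] and [M^T M] are the Moore-Penrose inverses of [A^T A] and [A A^T]. *)
pose S := M *m M^T *m B^T *m P + Q *m B^T *m M^T *m M - M *m B *m M.
(* The eps-parts of [A X] and [X A], written as [Z + Z^T], are visibly symmetric. *)
have eAS : A *m S + B *m M = P *m B *m M + (P *m B *m M)^T.
  rewrite !trmx_mul PT /S mulmxBr mulmxDr !mulmxA AMMt AQ !mul0mx addr0.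
  by rewrite -addrA addrC [P *m B]mulmxBl mul1mx mulmxBl (addrC (- _)).
have eSA : M *m B + S *m A = M *m B *m Q + (M *m B *m Q)^T.
  rewrite !trmx_mul QT /S mulmxBl mulmxDl -!mulmxA PA !mulmx0 add0r.
  rewrite (mulmxA M^T) MtMA addrCA addrC; congr (_ + _).
  by rewrite [B *m Q]mulmxBr mulmx1 mulmxBr.
exists (dual_mx M S); split.
- rewrite !mul_dual_mx AMA eAS; congr dual_mx.
  (* This is the corner condition [P B Q = 0] with [Q] expanded. *)
  have PBMA : P *m B *m M *m A = P *m B.
    move/eqP: B0; rewrite mulmxBr mulmx1 subr_eq0 => /eqP; rewrite -/P => e.
    by rewrite [RHS]e !mulmxA.
  rewrite mulmxDl PBMA !trmx_mul PT -!mulmxA PA !mulmx0 addr0.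
  by rewrite mulmxBl mul1mx mulmxA addrC subrK.
- rewrite !mul_dual_mx MAM eSA; congr dual_mx.
  rewrite mulmxDl !trmx_mul QT -(mulmxA (M *m B)) QM mulmx0 add0r.
  rewrite {1}/S mulmxBr mulmxDr !mulmxA MAM -(mulmxA M A Q) AQ.
  by rewrite mulmx0 !mul0mx addr0 addrAC.
- by rewrite mul_dual_mx tr_dual_mx sAM eAS linearD /= trmxK addrC.
- by rewrite mul_dual_mx tr_dual_mx sMA eSA linearD /= trmxK addrC.
Qed.

End DualMoorePenrose.

(** * The corner condition on [B] *)

Section DualIndex.
Variables (R : realType) (n : nat) (A B G : 'M[R]_n).
Hypotheses (AG : A *m G = G *m A) (AGA : A *m G *m A = A).

Let E := A *m G.

Let EA : (1%:M - E) *m A = 0. Proof. by rewrite mulmxBl mul1mx AGA subrr. Qed.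

Let AE : A *m (1%:M - E) = 0.
Proof. by rewrite mulmxBr mulmx1 /E AG mulmxA AGA subrr. Qed.

Lemma dual_sqr_factor_corner0 Y :
  dual_mx A B *m dual_mx A B *m Y = dual_mx A B ->
  (1%:M - E) *m B *m (1%:M - E) = 0.
Proof.
have [Y0 [Y1 ->]] := dual_mx_ex Y.
rewrite !mul_dual_mx => /dual_mx_inj[e0 e1].
(* The real part [A^2 Y0 = A] gives [A Y0 = G A^2 Y0 = G A]. This kills [B A Y0], the only term of
   the eps-part not starting with [A]. *)
have AYE : A *m Y0 *m (1%:M - E) = 0.
  have -> : A *m Y0 = G *m (A *m A *m Y0).
    by rewrite !mulmxA -AG AGA.
  by rewrite e0 -mulmxA AE mulmx0.
move: EA AYE; move: (1%:M - E) => P PA AYP.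
rewrite -e1 !(mulmxDl, mulmxDr) !mulmxA PA !mul0mx !add0r.
by rewrite -!mulmxA (mulmxA A Y0 P) AYP !mulmx0.
Qed.

(** The eps-part of [A X A = A] writes [B] as a sum of terms each starting or ending with [A]. *)
Lemma DMPGI_corner0 X : is_DMPGI (dual_mx A B) X ->
  (1%:M - E) *m B *m (1%:M - E) = 0.
Proof.
have [X0 [X1 ->]] := dual_mx_ex X.
move=> [+ _ _ _]; rewrite !mul_dual_mx => /dual_mx_inj[_ e1].
move: EA AE; move: (1%:M - E) => P PA AP.
rewrite -e1 !(mulmxDl, mulmxDr) !mulmxA PA !mul0mx !add0r.
by rewrite -!mulmxA AP !mulmx0.
Qed.

Lemma dual_sqr_factor_ex : (1%:M - E) *m B *m (1%:M - E) = 0 ->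
  exists Y, dual_mx A B *m dual_mx A B *m Y = dual_mx A B.
Proof.
move=> B0.
have BE : B *m (1%:M - E) = E *m (B *m (1%:M - E)).
  by apply/eqP; rewrite -subr_eq0 -{1}[B *m _]mul1mx -mulmxBl mulmxA B0.
have AAG : A *m A *m G = A by rewrite -mulmxA AG mulmxA AGA.
have AAGG : A *m A *m (G *m G) = E by rewrite mulmxA AAG.
(* With real part [G], the eps-part [Y1] must solve [A^2 Y1 = B - (A B + B A) G = B (1 - E) - A B
   G]. By [BE] and [E A = A], [E] fixes the right-hand side, and [A^2 G^2 = E]. *)
exists (dual_mx G (G *m G *m (B *m (1%:M - E) - A *m B *m G))).
rewrite !mul_dual_mx AAG; congr dual_mx.
rewrite (mulmxA (A *m A)) AAGG mulmxBr -BE !mulmxA AGA.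
by rewrite mulmxDl addrA subrK mulmxBr mulmx1 -(mulmxA B) subrK.
Qed.

(** [E] has the same range as [A M] and the same kernel as [M A], so the corner of [B] cut out by
    the Moore-Penrose projectors factors through the one cut out by [1 - E]. *)
Lemma corner0_DMPGI : (1%:M - E) *m B *m (1%:M - E) = 0 ->
  exists X, is_DMPGI (dual_mx A B) X.
Proof.
move=> B0; have [M [AMA MAM sAM sMA]] := moore_penrose_ex A.
apply: (DMPGI_ex AMA MAM sAM sMA).
have PE : (1%:M - A *m M) *m E = 0.
  by rewrite mulmxBl mul1mx /E mulmxA AMA subrr.
have EQ : E *m (1%:M - M *m A) = 0.
  by rewrite mulmxBr mulmx1 /E AG -mulmxA (mulmxA A) AMA subrr.
have -> : 1%:M - A *m M = (1%:M - A *m M) *m (1%:M - E).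
  by rewrite mulmxBr mulmx1 PE subr0.
have -> : 1%:M - M *m A = (1%:M - E) *m (1%:M - M *m A).
  by rewrite mulmxBl mul1mx EQ subr0.
by rewrite mulmxA -!(mulmxA (1%:M - A *m M)) B0 mul0mx mulmx0.
Qed.

End DualIndex.

Theorem theorem2p7 (R : realType) (n : nat) (A B : 'M[R]_n) :
  dual_index_one (dual_mx A B) <->
  index_one A /\ exists X : 'M[dual R]_n, is_DMPGI (dual_mx A B) X.
Proof.
rewrite dual_index_oneP; split=> [[Y eY]|[iA [X XP]]].
  (* The real part of the factorization already forces index one, which then provides [G]. *)
  have iA : index_one A.
    have [Y0 [Y1 eY01]] := dual_mx_ex Y.
    move: eY; rewrite eY01 !mul_dual_mx => /dual_mx_inj[e0 _].
    exact: rank_sqr_of_factor e0.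
  split=> //; have [G [AG AGA]] := group_inverse_ex iA.
  exact: corner0_DMPGI AG (dual_sqr_factor_corner0 AG AGA eY).
have [G [AG AGA]] := group_inverse_ex iA.
exact: dual_sqr_factor_ex AG AGA (DMPGI_corner0 AG AGA XP).
Qed.
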